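(* Let $\Gamma\curvearrowright(X,\mu)$ be an mcp (measure-class preserving) Borel action of a countable group $\Gamma$ on a standard probability space $(X,\mu)$. The action is chaining if and only if it is ergodic and every positive measure set is group generating.
   Context: $\mathbb{N}$ includes $0$. The action is mcp if for all Borel $A\subseteq X$ and $\gamma\in\Gamma$, $\mu(A)=0$ iff $\mu(\gamma A)=0$. It is ergodic if every $\Gamma$-invariant $\mu$-measurable set is null or conull. A measurable set $A\subseteq X$ is group generating if its set of return times $\Gamma_A=\{\gamma\in\Gamma:\mu(\gamma A\cap A)>0\}$ generates $\Gamma$. For $k\in\mathbb{N}$, $A$ $k$-chains to $B$ if there are $\gamma_0=1_\Gamma,\gamma_1,\dots,\gamma_k\in\Gamma$ with $\mu(\gamma_iA\cap\gamma_{i+1}A)>0$ for each $0\le i<k$ and $\mu(\gamma_kA\cap B)>0$. The action is chaining if for all sets $A,B\subseteq X$ of positive measure there is $\ell\in\mathbb{N}$ such that $A$ $\ell$-chains to $B$. *)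

(* Defs.v *)
From mathcomp Require Import all_boot all_order all_algebra.
From mathcomp Require Import monoid.
From mathcomp Require Import all_classical all_reals all_analysis.
From mathcomp Require Import measurable_realfun.

Set Implicit Arguments.
Unset Strict Implicit.
Unset Printing Implicit Defensive.

Local Open Scope classical_set_scope.
Local Open Scope group_scope.
Local Open Scope ereal_scope.

Definition polish (R : realType) (M : metricType R) : Prop :=
  (forall F : set_system M, ProperFilter F -> cauchy F ->
     exists x : M, F --> x) /\
  (exists2 D : set M, countable D & dense D).

(* A measurable space is standard Borel if it is Borel isomorphic to a Polish
   space equipped with its Borel sigma-algebra. *)
Definition standard_borel (R : realType) (d : measure_display)
    (X : measurableType d) : Prop :=
  exists (M : metricType R) (f : X -> M) (g : M -> X),
    [/\ polish M, cancel f g, cancel g f,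
        (forall B : set M, <<s @open M >> B -> measurable (f @^-1` B)) &
        (forall A : set X, measurable A -> <<s @open M >> (g @^-1` A))].

Definition group_action (G : groupType) (X : Type) (act : G -> X -> X) : Prop :=
  (forall x, act 1%g x = x) /\
  (forall g h x, act (g * h)%g x = act g (act h x)).

(* The acting group is countable and discrete, so Borelness of the map
   G * X -> X is Borelness of the action of each group element. *)
Definition borel_action (G : groupType) (d : measure_display)
    (X : measurableType d) (act : G -> X -> X) : Prop :=
  group_action act /\ forall g, measurable_fun setT (act g).

Definition subgroup (G : groupType) (H : set G) : Prop :=
  group_closed [in H].

Definition generates (G : groupType) (S : set G) : Prop :=
  smallest (@subgroup G) S = setT.

Section actions.
Context (R : realType) (d : measure_display) (X : measurableType d).
Context (mu : probability X R) (G : groupType) (act : G -> X -> X).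
Implicit Types A B : set X.

(* [completed_algebra_gen mu] is the completion of the sigma-algebra of [X] with
   respect to [mu], and [mu^*] is the outer measure of [mu], which restricts on
   it to the completed measure. *)
Definition mu_measurable A : Prop := completed_algebra_gen mu A.

Definition mubar : set X -> \bar R := (mu^*)%mu.

Definition positive_measure A : Prop := mu_measurable A /\ 0 < mubar A.

Definition mcp : Prop :=
  forall A g, measurable A -> (mu A = 0 <-> mu (act g @` A) = 0).

Definition invariant_set A : Prop := forall g, act g @` A = A.

Definition ergodic : Prop :=
  forall A, mu_measurable A -> invariant_set A ->
    mubar A = 0 \/ mubar (~` A) = 0.

Definition return_times A : set G :=
  [set g | 0 < mubar (act g @` A `&` A)].

Definition group_generating A : Prop := generates (return_times A).

(* Only the values of [gamma] at 0, ..., k matter. *)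
Definition chains_to (k : nat) A B : Prop :=
  exists gamma : nat -> G,
    [/\ gamma 0%N = 1%g,
        (forall i, (i < k)%N ->
          0 < mubar (act (gamma i) @` A `&` act (gamma i.+1) @` A)) &
        0 < mubar (act (gamma k) @` A `&` B)].

Definition chaining : Prop :=
  forall A B, positive_measure A -> positive_measure B ->
    exists l : nat, chains_to l A B.

End actions.

(* Main.v *)
Require Import Defs.
From mathcomp Require Import all_boot all_order all_algebra.
From mathcomp Require Import monoid.
From mathcomp Require Import all_classical all_reals all_analysis.
From mathcomp Require Import measurable_realfun.

(** Being a return time of [A] means [gA] meets [A] in positive measure, and by
    quasi-invariance [gA] meets [hA] in positive measure iff [g^-1 h] is a return
    time. So the elements reached by chains starting at [1] are exactly those of
    the subgroup generated by the return times of [A]. If that subgroup is the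
    whole group, [A] chains to [B] as soon as one translate of [A] meets [B],
    which ergodicity provides. Conversely, a chain from [A] to [gA] exhibits [g]
    in the subgroup, and a chain from an invariant set cannot leave it. *)

Import Order.TTheory GRing.Theory Num.Theory.

Local Open Scope classical_set_scope.

(** * Null sets of the outer measure *)

Section outer_null_sets.
Local Open Scope ereal_scope.
Context {R : realType} {d : measure_display} {X : measurableType d}.
Context {mu : probability X R}.
Implicit Types A B E N : set X.

Lemma mubar_ge0 E : 0 <= mubar mu E.
Proof. exact: mu_ext_ge0. Qed.

Lemma mubarE E : measurable E -> mubar mu E = mu E.
Proof. by move=> mE; rewrite /mubar measurable_mu_extE. Qed.

Lemma le_mubar A B : A `<=` B -> mubar mu A <= mubar mu B.
Proof. exact: le_mu_ext. Qed.

(** For each [n], cover [E] by measurable sets of total mass below [1 / (n + 1)]; intersecting the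
    unions of these covers over [n] gives a measurable null set containing [E]. *)
Lemma mubar0_negligible E : mubar mu E = 0 -> mu.-negligible E.
Proof.
move=> E0.
have cover n : exists F : (set X)^nat, measurable_cover E F /\
    \sum_(k <oo) mu (F k) < n.+1%:R^-1%:E.
  have fin : mubar mu E \is a fin_num by rewrite E0.
  have n0 : (0 < n.+1%:R^-1 :> R)%R by rewrite invr_gt0.
  have [_ [F EF <-]] := lb_ereal_inf_adherent n0 fin.
  by rewrite [X in X + _]E0 add0e => lt; exists F.
have [F HF] := choice cover.
have mU n : measurable (\bigcup_m F n m).
  by apply: bigcupT_measurable => m; case: (HF n) => -[].
have mI : measurable (\bigcap_n \bigcup_m F n m) by exact: bigcapT_measurable.
exists (\bigcap_n \bigcup_m F n m); split => //; last first.
  by move=> x Ex n _; case: (HF n) => -[_ EF] _; exact: EF.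
apply/eqP; rewrite eq_le measure_ge0 andbT.
apply/lee_addgt0Pr => /= e e0; rewrite add0e.
have [n ne] : exists n, (n.+1%:R^-1 < e)%R.
  have [n _ /(_ n (leqnn n)) ne] := near_infty_natSinv_lt (PosNum e0).
  by exists n.
apply: (@le_trans _ _ (mu (\bigcup_m F n m))).
  by apply: le_measure; rewrite ?inE//; exact: bigcap_inf.
case: (HF n) => -[mF _] lt.
apply: le_trans (measure_sigma_subadditive mu mF (mU n) (@subset_refl _ _)) _.
by rewrite (le_trans (ltW lt))// lee_fin ltW.
Qed.

Lemma mubar_eq0 E : mubar mu E = 0 <-> mu.-negligible E.
Proof.
split=> [|[N [mN N0 EN]]]; first exact: mubar0_negligible.
by apply/eqP; rewrite eq_le mubar_ge0 andbT -N0 -mubarE// le_mubar.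
Qed.

(** Trades positivity for non-negligibility, so that arguments about overlaps become manipulations
    of negligible sets. *)
Lemma mubar_gt0 E : 0 < mubar mu E <-> ~ mu.-negligible E.
Proof.
rewrite lt_def mubar_ge0 andbT -mubar_eq0.
by split=> /eqP.
Qed.

Lemma mu_measurable_measurable A : measurable A -> mu_measurable mu A.
Proof.
by move=> mA; exists A => //; exists set0; [exact: negligible_set0|rewrite setU0].
Qed.

Lemma mu_measurableC A : mu_measurable mu A -> mu_measurable mu (~` A).
Proof.
move=> [C mC [N [F [mF F0 NF]] <-]].
(* Here [A] is [C] together with [N], and [F] is a measurable null set containing [N]. Removing all
   of [F] keeps the core measurable; what is lost lies in [F]. *)
exists (~` (C `|` F)); first by apply: measurableC; exact: measurableU.
exists (F `&` ~` (C `|` N)); first by exists F; split=> // x [].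
apply/seteqP; split=> x /=; first by move=> [nCF [|/NF]|[]]; tauto.
by have [Fx|Fx] := pselect (F x); tauto.
Qed.

Lemma negligible_bigcup_countable (I : choiceType) (F : I -> set X) :
  countable [set: I] -> (forall i, mu.-negligible (F i)) ->
  mu.-negligible (\bigcup_i F i).
Proof.
move=> /countable_injP[f finj] F0.
(* Regroup the union along the injection [f] into the naturals: each fibre holds at most one
   index. *)
suff : mu.-negligible (\bigcup_n \bigcup_(i in f @^-1` [set n]) F i).
  by apply: negligibleS => x [i _ Fx]; exists (f i) => //; exists i.
apply: negligible_bigcup => n.
have [[i fi]|ni] := pselect (exists i, f i = n).
  apply: negligibleS (F0 i) => x [j /= fj Fx].
  by rewrite (finj i j) ?inE// fi fj.
rewrite bigcup0; first exact: negligible_set0.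
by move=> i /= fi; case: ni; exists i.
Qed.

End outer_null_sets.

(** * Translates of sets under the action *)

Section return_times.
Local Open Scope ereal_scope.
Local Open Scope group_scope.
Context {R : realType} {d : measure_display} {X : measurableType d}.
Context {mu : probability X R} {G : groupType} {act : G -> X -> X}.
Hypothesis act_borel : borel_action act.
Hypothesis act_mcp : mcp mu act.
Implicit Types (A B E : set X) (g h u v : G).

Let act_1 x : act 1 x = x. Proof. by case: act_borel => -[]. Qed.
Let act_M g h x : act (g * h) x = act g (act h x).
Proof. by case: act_borel => -[]. Qed.
Let act_K g : cancel (act g) (act g^-1).
Proof. by move=> x; rewrite -act_M mulVg act_1. Qed.
Let act_VK g : cancel (act g^-1) (act g).
Proof. by move=> x; rewrite -act_M mulgV act_1. Qed.

Lemma image_act1 E : act 1 @` E = E.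
Proof.
apply/seteqP; split=> [_ [x Ex <-]|x Ex]; first by rewrite act_1.
by exists x.
Qed.

Lemma image_actM g h E : act (g * h) @` E = act g @` (act h @` E).
Proof. by rewrite image_comp; apply: eq_imagel => x _ /=; rewrite act_M. Qed.

(** As preimages, translates commute with intersections and inherit measurability from the Borel
    action. *)
Lemma image_act_preimage g E : act g @` E = act g^-1 @^-1` E.
Proof.
apply/seteqP; split=> [_ [x Ex <-]|x Ex] /=; first by rewrite act_K.
by exists (act g^-1 x) => //; rewrite act_VK.
Qed.

Lemma image_actI g A B : act g @` (A `&` B) = act g @` A `&` act g @` B.
Proof. by rewrite !image_act_preimage preimage_setI. Qed.

Lemma measurable_image_act g E : measurable E -> measurable (act g @` E).
Proof.
move=> mE; rewrite image_act_preimage -[X in measurable X]setTI.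
by case: act_borel => _; apply.
Qed.

Lemma negligible_image_act g E :
  mu.-negligible (act g @` E) <-> mu.-negligible E.
Proof.
(* The converse is the same implication applied to [g^-1]. *)
suff im h B : mu.-negligible B -> mu.-negligible (act h @` B).
  split=> [/(im g^-1)|]; last exact: im.
  by rewrite -image_actM mulVg image_act1.
move=> [N [mN N0 BN]]; exists (act h @` N); split; last exact: image_subset.
- exact: measurable_image_act.
- exact: (act_mcp N h mN).1.
Qed.

Lemma mubar_image_act_gt0 g E :
  0 < mubar mu (act g @` E) <-> 0 < mubar mu E.
Proof. by rewrite !mubar_gt0 negligible_image_act. Qed.

Lemma positive_measure_image_act g A :
  positive_measure mu A -> positive_measure mu (act g @` A).
Proof.
move=> [[C mC [N N0 <-]] A0]; split; last exact/mubar_image_act_gt0.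
exists (act g @` C); first exact: measurable_image_act.
by exists (act g @` N); [exact/negligible_image_act|rewrite image_setU].
Qed.

(** * Chains and the subgroup generated by the return times *)

Lemma mubar_translates_gt0 u g h A B :
  0 < mubar mu (act (u * g) @` A `&` act (u * h) @` B) <->
  0 < mubar mu (act g @` A `&` act h @` B).
Proof. by rewrite !image_actM -image_actI mubar_image_act_gt0. Qed.

Lemma return_timesP A g h :
  0 < mubar mu (act g @` A `&` act h @` A) <-> return_times mu act A (h^-1 * g).
Proof. by rewrite -(mubar_translates_gt0 h^-1) mulVg image_act1. Qed.

(** Each quotient [(gamma i)^-1 * gamma i.+1] is a return time, and [gamma k] is the product of
    these quotients. *)
Lemma smallest_return_times_path A (k : nat) (gamma : nat -> G) (H : set G) :
  subgroup H -> return_times mu act A `<=` H -> gamma 0%N = 1 ->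
  (forall i, (i < k)%N ->
     0 < mubar mu (act (gamma i) @` A `&` act (gamma i.+1) @` A)) ->
  H (gamma k).
Proof.
move=> sH AH g0; elim: k => [_|k IHk pos].
  by rewrite g0 -in_setE; case: sH.
have /IHk Hk : forall i, (i < k)%N ->
    0 < mubar mu (act (gamma i) @` A `&` act (gamma i.+1) @` A).
  by move=> i ik; apply: pos; rewrite ltnS ltnW.
have /AH Hr : return_times mu act A ((gamma k)^-1 * gamma k.+1).
  by apply/return_timesP; rewrite setIC; exact: pos.
rewrite -[gamma _](mulVKg (gamma k)) -in_setE.
by apply: (group_closedM sH); rewrite in_setE.
Qed.

Definition chain_reachable A : set G :=
  [set g | exists (k : nat) (gamma : nat -> G),
    [/\ gamma 0%N = 1,
        (forall i, (i < k)%N ->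
          0 < mubar mu (act (gamma i) @` A `&` act (gamma i.+1) @` A)) &
        gamma k = g]].

Lemma subgroup_chain_reachable A : subgroup (chain_reachable A).
Proof.
split; first by rewrite in_setE; exists 0%N, (fun=> 1).
move=> u v; rewrite !in_setE => -[k [p [p0 pk pu]]] [l [q [q0 ql qv]]].
(* Follow the chain to [u], then the chain to [v] backwards, translated by
   [u / v] so that it runs from [u] to [u / v]. *)
pose r i := if (i <= k)%N then p i else u / v * q (l - (i - k))%N.
(* The two branches agree at the junction [i = k], because [q l = v] and [u / v * v = u = p k]. *)
have rk i : (k <= i)%N -> r i = u / v * q (l - (i - k))%N.
  rewrite leq_eqVlt /r => /orP[/eqP <-|ki]; last by rewrite leqNgt ki.
  by rewrite leqnn subnn subn0 qv pu mulgVK.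
exists (k + l)%N, r; split=> [|i ikl|]; first by rewrite /r.
- have [ik|ki] := ltnP i k; first by rewrite /r ik ltnW//; exact: pk.
  rewrite !rk ?(leqW ki)// mubar_translates_gt0 setIC.
  (* As [k <= i < k + l], the truncated subtraction is a successor, so this link is a link of [q]
     read backwards. *)
  have -> : (l - (i - k) = (l - (i.+1 - k)).+1)%N.
    by rewrite subSn// subnSK// ltn_subLR.
  by apply: ql; rewrite subSn// ltn_subrL/= -(ltn_add2l k) addn0 (leq_ltn_trans ki).
- by rewrite rk ?leq_addr// addKn subnn q0 mulg1.
Qed.

Lemma return_times_chain_reachable A :
  return_times mu act A `<=` chain_reachable A.
Proof.
move=> g Ag; exists 1%N, (fun i => if i is 0%N then 1 else g); split=> // -[|//] _.
by rewrite image_act1 setIC.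
Qed.

(** * From chaining to ergodicity and generation, and back *)

Lemma chaining_ergodic : chaining mu act -> ergodic mu act.
Proof.
move=> ch A mA Ainv.
have [/mubar_eq0 A0|/mubar_gt0 A0] := pselect (mu.-negligible A); first by left.
have [/mubar_eq0 B0|/mubar_gt0 B0] := pselect (mu.-negligible (~` A)).
  by right.
have [l [gamma [_ _]]] := ch A (~` A) (conj mA A0) (conj (mu_measurableC _ mA) B0).
by rewrite Ainv setICr => /mubar_gt0; case; exact: negligible_set0.
Qed.

Lemma chaining_group_generating A :
  chaining mu act -> positive_measure mu A -> group_generating mu act A.
Proof.
move=> ch A0; apply/seteqP; split=> // g _ H /= [sH AH].
have [l [gamma [g0 steps last]]] := ch _ _ A0 (positive_measure_image_act g _ A0).
have Hl := smallest_return_times_path _ _ _ _ sH AH g0 steps.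
have /AH Hr : return_times mu act A ((gamma l)^-1 * g).
  by apply/return_timesP; rewrite setIC.
rewrite -[g](mulVKg (gamma l)) -in_setE.
by apply: (group_closedM sH); rewrite in_setE.
Qed.

Lemma ergodic_translate_meets A B : countable [set: G] -> ergodic mu act ->
  positive_measure mu A -> positive_measure mu B ->
  exists g, 0 < mubar mu (act g @` A `&` B).
Proof.
move=> cG erg [[C mC [N N0 <-]] A0] [_ B0].
(* Saturating the measurable core [C] of [A] makes [U] a countable union of measurable sets. *)
pose U := \bigcup_g act g @` C.
have mU : mu_measurable mu U.
  apply: mu_measurable_measurable; apply: countable_bigcupT_measurable => // g.
  exact: measurable_image_act.
have Uinv : invariant_set act U.
  move=> g; rewrite image_bigcup; apply/seteqP; split=> x [h _ Cx].
    by exists (g * h) => //; rewrite image_actM.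
  by exists (g^-1 * h) => //; rewrite -image_actM mulVKg.
have [/mubar_eq0 U0|/mubar_eq0 U0] := erg _ mU Uinv.
  move/mubar_gt0: A0; case; apply: negligibleU => //.
  by apply: negligibleS U0 => x Cx; exists 1 => //; rewrite image_act1.
apply: contrapT => /forallNP AB0; move/mubar_gt0: B0; apply.
have CB0 g : mu.-negligible (act g @` C `&` B).
  apply: contrapT => /mubar_gt0 CB; apply: (AB0 g); apply: lt_le_trans CB _.
  by apply: le_mubar; apply: setSI; apply: image_subset; exact: subsetUl.
have := negligibleU U0 (negligible_bigcup_countable _ _ cG CB0).
apply: negligibleS => x Bx; have [[g _ Cx]|] := pselect (U x); last by left.
by right; exists g.
Qed.

Lemma ergodic_generating_chaining : countable [set: G] -> ergodic mu act ->
  (forall A, positive_measure mu A -> group_generating mu act A) ->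
  chaining mu act.
Proof.
move=> cG erg gen A B A0 B0.
have [g gAB] := ergodic_translate_meets _ _ cG erg A0 B0.
(* The chain-reachable elements form a subgroup containing the return times, so [g] is the endpoint
   of a chain. *)
have : smallest (@subgroup G) (return_times mu act A) g by rewrite gen.
move=> /(_ _ (conj (subgroup_chain_reachable A) (return_times_chain_reachable A))).
by move=> [k [gamma [g0 steps gk]]]; exists k, gamma; rewrite gk.
Qed.

End return_times.

Theorem proposition4p4 (R : realType) (d : measure_display)
    (X : measurableType d) (mu : probability X R) (G : groupType)
    (act : G -> X -> X)
    (X_standard : standard_borel R X)
    (G_countable : countable [set: G])
    (act_borel : borel_action act)
    (act_mcp : mcp mu act) :
  chaining mu act <->
  (ergodic mu act /\
   forall A : set X, positive_measure mu A -> group_generating mu act A).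
Proof.
split=> [ch|[erg gen]]; last exact: ergodic_generating_chaining.
split; first exact: chaining_ergodic.
by move=> A; exact: chaining_group_generating.
Qed.
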